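(* When $\beta\neq0$, the ring $\mathcal{K}_j$ is a finite commutative chain ring with unity whose ideals are given by $$\{0\}\subset\langle f_j(x)^{2p^s-1}\rangle\subset\langle f_j(x)^{2p^s-2}\rangle\subset\cdots\subset\langle f_j(x)^2\rangle\subset\langle f_j(x)\rangle\subset\mathcal{K}_j.$$ Moreover, for $0\le\nu\le2p^s$, the ideal $\langle f_j(x)^\nu\rangle$ has $p^{md_j(2p^s-\nu)}$ elements and the orthogonal complement of $\langle f_j(x)^\nu\rangle$ is given by $\langle f_j^*(x)^{2p^s-\nu}\rangle$ (an ideal of $\widehat{\mathcal{K}_j}$).
   Context: $\mathcal{R}_2$ is a finite commutative chain ring with unity, with maximal ideal $\langle\gamma\rangle$, where $\gamma\neq0$ and $\gamma^2=0$; its residue field has order $p^m$, $p$ prime. $\zeta\in\mathcal{R}_2$ has multiplicative order $p^m-1$ and $\mathcal{T}_2=\{0,1,\zeta,\dots,\zeta^{p^m-2}\}$. $n,s$ are positive integers with $\gcd(n,p)=1$. $\alpha\in\mathcal{T}_2\setminus\{0\}$, $\beta\in\mathcal{T}_2$, $\lambda=\alpha+\gamma\beta$, and $\alpha_0\in\mathcal{T}_2$ satisfies $\alpha_0^{p^s}=\alpha$. Write $x^n-\alpha_0=f_1(x)\cdots f_r(x)$ with $f_j$ monic, pairwise coprime and basic irreducible (irreducible modulo $\gamma$) in $\mathcal{R}_2[x]$, $d_j=\deg f_j$. Then $x^{np^s}-\lambda=\prod_{j=1}^rk_j(x)$ with $k_j(x)=f_j(x)^{p^s}+\gamma g_j(x)$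 monic, pairwise coprime, of degree $d_jp^s$, for certain $g_j\in\mathcal{R}_2[x]$ (the $k_j$ are uniquely determined by these properties). Fix $1\le j\le r$ and put $\mathcal{K}_j=\mathcal{R}_2[x]/\langle k_j(x)\rangle$ and $\widehat{\mathcal{K}_j}=\mathcal{R}_2[x]/\langle k_j^*(x)\rangle$. For a nonzero polynomial $f$, $f^*(x)=x^{\deg f}f(x^{-1})$, and $0^*=0$; elements of $\mathcal{K}_j$ are represented by polynomials of degree less than $d_jp^s$. The orthogonal complement of an ideal $\mathcal{I}$ of $\mathcal{K}_j$ is $\mathcal{I}^\perp=\{a(x)\in\widehat{\mathcal{K}_j}:a(x)c^*(x)=0\text{ in }\widehat{\mathcal{K}_j}\text{ for all }c(x)\in\mathcal{I}\}$. *)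

(* Defs.v *)
From HB Require Import structures.
From mathcomp Require Import all_boot all_algebra.

Set Implicit Arguments.
Unset Strict Implicit.
Unset Printing Implicit Defensive.

Import GRing.Theory.
Local Open Scope ring_scope.
Local Open Scope quotient_scope.

HB.instance Definition _ (R : finComNzRingType) (h : {poly R}) :=
  Finite.on {poly %/ h}.

Section Ideals.

Variable A : finComNzRingType.

Definition is_ideal (I : {set A}) : Prop :=
  [/\ 0 \in I,
      {in I &, forall u v, u + v \in I} &
      forall a, {in I, forall u, a * u \in I}].

Definition maximal_ideal (M : {set A}) : Prop :=
  [/\ is_ideal M, M != [set: A] &
      forall J : {set A}, is_ideal J -> M \proper J -> J = [set: A]].

Definition chain_ring : Prop :=
  forall I J : {set A}, is_ideal I -> is_ideal J ->
    (I \subset J) || (J \subset I).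

Definition pideal (x : A) : {set A} := [set q * x | q : A].

End Ideals.

Arguments chain_ring A : clear implicits.

(* Counterpart of [pideal] for rings without a finType structure, such as
   {poly R} and its quotients by [ideal_quot]. *)
Definition in_pideal (A : comNzRingType) (x a : A) : Prop :=
  exists q : A, a = q * x.

(* Over a ring that is not a domain, coprimality of polynomials means that the
   ideals they generate are comaximal; [coprimep] requires an idomainType. *)
Definition comaximal (A : comNzRingType) (x y : A) : Prop :=
  exists u v : A, u * x + v * y = 1.

Definition teichmuller (R : finComNzRingType) (N : nat) (zeta : R) : {set R} :=
  0 |: [set zeta ^+ i | i : 'I_N].

(* x^(deg f) f(1/x); it is 0 for f = 0, since size 0 = 0. *)
Definition recip (R : nzRingType) (f : {poly R}) : {poly R} :=
  \poly_(i < size f) f`_((size f).-1 - i).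

(* {poly %/ h} denotes R[x]/<h> only when h is monic of positive degree.  The
   reciprocal of a monic polynomial is in general not monic, so R[x]/<recip h>
   is rendered by {ideal_quot J}, for J the ideal generated by recip h.  An
   element c of {poly %/ h} is its representative of degree < deg h, and
   recip is applied to that representative. *)
Definition orth_compl (R : finComNzRingType) (h : {poly R})
    (J : idealr {poly R}) (C : {set {poly %/ h}}) (a : {ideal_quot J}) : Prop :=
  forall c : {poly %/ h}, c \in C -> a * \pi_{ideal_quot J} (recip (c : {poly R})) = 0.

(* Main.v *)
Require Import Defs.
From HB Require Import structures.
From mathcomp Require Import all_boot all_algebra.
From mathcomp Require Import ring.

Set Implicit Arguments.
Unset Strict Implicit.
Unset Printing Implicit Defensive.

Import GRing.Theory.
Local Open Scope ring_scope.
Local Open Scope quotient_scope.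

(** The ring K = R[x]/(k_j) is a finite commutative ring in which every element
is either invertible or a multiple of f_j, and in which f_j is nilpotent of
exact index N = 2 p^s.  Everything except the orthogonal complement follows
formally from that.  In a finite ring with such a uniformizer t, every element
is a unit times a power of t, so an ideal is generated by the lowest power of t
that it contains ([ideal_uniformizer]); the annihilator of t^m is (t^(N-m))
([annihilatorX]); and multiplication by t maps (t^m) onto (t^(m+1)) with kernel
(t^(N-1)) when m < N, so that (t^m) has |(t^(N-1))|^(N-m) elements
([card_pidealX]).  The same facts for R itself, with t = gamma and N = 2, give
|R| = |F|^2; then |K| = |R|^(deg k_j) determines |(t^(N-1))| in K.

That f_j is a uniformizer rests on the identity f_j^(p^s) = gamma v in K with v
invertible.  Since p is a multiple of gamma and gamma^2 = 0, the Frobenius map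
is additive up to controlled multiples of gamma, and
  x^(p^i) - a^(p^i) = (x - a)^(p^i) + gamma (x - a) e
for some e ([subr_exprpX]).  With x^n for x and alpha_0 for a, the left-hand
side is gamma beta in K.  There x^n - alpha_0 is f_j times an invertible
element, because the other factors f_i are comaximal with the nilpotent f_j.
So f_j^(p^s) is, up to a unit, gamma times beta plus a nilpotent, and beta, a
nonzero Teichmuller representative, is invertible ([exprp_unit_mul]).  The
index of nilpotency is then exact, because gamma f_j^(p^s - 1) has degree less
than deg k_j and is not zero.  Finally a polynomial prime to f_j modulo gamma
is invertible in K: a Bezout relation over the residue field lifts to R up to
a multiple of gamma, hence up to a nilpotent ([qpoly_invertible_or_mul]).

For the orthogonal complement, write q' for the reciprocal of q.  The variable
is invertible modulo k_j', and x |-> x^-1 induces an isomorphism phi from K onto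
R[x]/(k_j') under which c' = x^(deg c) phi(c).  Hence phi(b) c' is zero exactly
when b c is zero in K, and the complement of (f_j^nu) is the image under phi of
the annihilator of f_j^nu, that is, of (f_j^(N-nu))
([recip_orthogonal_uniformizer]). *)

(** * Invertible elements *)

Section Invertible.

Variable A : comNzRingType.
Implicit Types a b x y : A.

Definition invertible a := exists b, b * a = 1.

Lemma invertible1 : invertible 1.
Proof. by exists 1; rewrite mulr1. Qed.

Lemma invertibleM a b : invertible a -> invertible b -> invertible (a * b).
Proof.
by move=> [a' a'a] [b' b'b]; exists (a' * b'); rewrite mulrACA a'a b'b mulr1.
Qed.

Lemma invertibleX a n : invertible a -> invertible (a ^+ n).
Proof. by move=> [b ba]; exists (b ^+ n); rewrite -exprMn ba expr1n. Qed.

Lemma invertibleN a : invertible a -> invertible (- a).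
Proof. by move=> [b ba]; exists (- b); rewrite mulrNN. Qed.

Lemma invertible_factor a b : invertible (a * b) -> invertible a.
Proof. by move=> [c cab]; exists (c * b); rewrite -mulrA [b * a]mulrC. Qed.

Lemma invertible_prod (I : Type) (r : seq I) (P : pred I) (E : I -> A) :
  (forall i, P i -> invertible (E i)) ->
  invertible (\prod_(i <- r | P i) E i).
Proof.
by apply: (big_ind invertible); [exact: invertible1 | exact: invertibleM].
Qed.

Lemma invertible_inj a x y : invertible a -> a * x = a * y -> x = y.
Proof.
by move=> [b ba] /(congr1 (fun z => b * z)); rewrite !mulrA ba !mul1r.
Qed.

(** Up to a unit, a + x y is 1 - z with z nilpotent, and a geometric sum inverts
it. *)
Lemma invertible_addM_nilpotent a x y n :
  invertible a -> x ^+ n = 0 -> invertible (a + x * y).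
Proof.
move=> [b ba] xn0; apply: (@invertible_factor _ b).
have -> : (a + x * y) * b = 1 - x * (- (y * b)).
  by rewrite mulrN opprK mulrDl [a * b]mulrC ba mulrA.
set z := x * _; have zn0 : z ^+ n = 0 by rewrite exprMn xn0 mul0r.
exists (\sum_(i < n) z ^+ i); rewrite mulrC.
by rewrite -[1 - z]opprB mulNr -subrX1 zn0 sub0r opprK.
Qed.

End Invertible.

Lemma rmorph_invertible (A B : comNzRingType) (h : {rmorphism A -> B}) a :
  invertible a -> invertible (h a).
Proof. by move=> [b ba]; exists (h b); rewrite -rmorphM ba rmorph1. Qed.

(** * Principal ideals and counting *)

Lemma card_fibres (U V : finZmodType) (h : U -> V) (D : {set U}) :
  (forall x y, h (x - y) = h x - h y) ->
  (forall x y, x \in D -> y \in D -> x - y \in D) ->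
  #|D| = (#|[set h x | x in D]| * #|[set x in D | h x == 0%R]|)%N.
Proof.
move=> hB DB; rewrite -sum1_card (partition_big_imset h) /=.
rewrite -sum_nat_const; apply: eq_bigr => _ /imsetP[x0 Dx0 ->].
rewrite sum1dep_card.
rewrite -(card_imset [set x in D | h x == 0] (addIr x0)).
apply: eq_card => x; rewrite inE; apply/andP/imsetP => [[Dx /eqP hx]|].
  by exists (x - x0); rewrite ?subrK // inE DB // hB hx subrr eqxx.
have h0 : h 0 = 0 by rewrite -(subrr x0) hB subrr.
have D0 : 0 \in D by rewrite -(subrr x0) DB.
have hN y : h (- y) = - h y by rewrite -sub0r hB h0 sub0r.
move=> [y]; rewrite inE => /andP[Dy /eqP hy ->].
have -> : y + x0 = y - (0 - x0) by rewrite sub0r opprK.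
by rewrite !DB // !hB hy h0 !sub0r opprK eqxx.
Qed.

Section PrincipalIdeals.

Variable A : finComNzRingType.

Lemma mem_pideal (x a : A) : reflect (exists b, a = b * x) (a \in pideal x).
Proof.
apply: (iffP imsetP) => [[b _ ->]|[b ->]]; first by exists b.
by exists b.
Qed.

Lemma pideal_is_ideal (x : A) : is_ideal (pideal x).
Proof.
split=> [|_ _ /mem_pideal[a ->] /mem_pideal[b ->]|c _ /mem_pideal[a ->]].
- by apply/mem_pideal; exists 0; rewrite mul0r.
- by apply/mem_pideal; exists (a + b); rewrite mulrDl.
- by apply/mem_pideal; exists (c * a); rewrite mulrA.
Qed.

Lemma pideal1 : pideal (1 : A) = [set: A].
Proof.
by apply/setP => a; rewrite inE; apply/mem_pideal; exists a; rewrite mulr1.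
Qed.

Lemma pideal0 : pideal (0 : A) = [set 0].
Proof.
apply/setP => a; rewrite inE; apply/mem_pideal/eqP => [[b ->]|->].
  by rewrite mulr0.
by exists 0; rewrite mulr0.
Qed.

End PrincipalIdeals.

(** * Finite rings with a nilpotent uniformizer *)

Section Uniformizer.

Variables (A : finComNzRingType) (t : A) (N : nat).

Hypothesis invertible_or_mul :
  forall a : A, invertible a \/ exists b, a = b * t.
Hypothesis t_nilp : t ^+ N = 0.

Lemma pideal_subX m n : (m <= n)%N -> pideal (t ^+ n) \subset pideal (t ^+ m).
Proof.
move=> le_mn; apply/subsetP => _ /mem_pideal[a ->]; apply/mem_pideal.
by exists (a * t ^+ (n - m)); rewrite -mulrA -exprD subnK.
Qed.

Lemma uniformizer_factor a :
  exists u m, [/\ invertible u, (m <= N)%N & a = u * t ^+ m].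
Proof.
(* units split off one power of t at a time, and t ^+ N = 0 ends the process *)
have factor_upto n :
    (exists u m, [/\ invertible u, (m <= n)%N & a = u * t ^+ m])
    \/ exists b, a = b * t ^+ n.
  elim: n => [|n [[u [m [uu mn ->]]]|[b ->]]].
  - by right; exists a; rewrite mulr1.
  - by left; exists u, m; split=> //; apply: leqW.
  - have [ub|[c ->]] := invertible_or_mul b; first by left; exists b, n.
    by right; exists c; rewrite exprS mulrA.
have [//|[b ->]] := factor_upto N.
exists 1, N; split=> //; first exact: invertible1.
by rewrite t_nilp !mulr0.
Qed.

(** The generator is the lowest power of t in the ideal: an element u t^l with u
invertible puts t^l itself in the ideal. *)
Lemma ideal_uniformizer (I : {set A}) :
  is_ideal I -> exists2 m, (m <= N)%N & I = pideal (t ^+ m).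
Proof.
case=> I0 ID IM.
have exI : exists m, t ^+ m \in I by exists N; rewrite t_nilp.
case: (ex_minnP exI) => m Im min_m.
exists m; first by apply: min_m; rewrite t_nilp.
apply/eqP; rewrite eqEsubset; apply/andP; split; apply/subsetP => a.
  have [u [l [[u' u'u] _ ->]]] := uniformizer_factor a.
  move=> /(IM u'); rewrite mulrA u'u mul1r => /min_m le_ml.
  apply/mem_pideal; exists (u * t ^+ (l - m)).
  by rewrite -mulrA -exprD subnK.
by case/mem_pideal=> b ->; apply: IM.
Qed.

Lemma uniformizer_chain_ring : chain_ring A.
Proof.
move=> I J /ideal_uniformizer[m _ ->] /ideal_uniformizer[l _ ->].
have [le_ml|/ltnW le_lm] := leqP m l; apply/orP; [right|left];
  exact: pideal_subX.
Qed.

Hypothesis t_neq0 : t ^+ N.-1 != 0.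

Lemma uniformizerX_neq0 m : (m < N)%N -> t ^+ m != 0.
Proof.
move=> lt_mN; apply: contraNneq t_neq0 => tm0.
have le_m : (m <= N.-1)%N by case: (N) lt_mN.
by rewrite -(subnK le_m) exprD tm0 mulr0.
Qed.

Lemma annihilatorX m a :
  (m <= N)%N -> a * t ^+ m = 0 <-> exists b, a = b * t ^+ (N - m).
Proof.
move=> le_mN; split=> [|[b ->]]; last first.
  by rewrite -mulrA -exprD subnK ?t_nilp ?mulr0.
have [u [l [uu _ ->]]] := uniformizer_factor a.
rewrite -mulrA -exprD -[0](mulr0 u) => /(invertible_inj uu) tlm0.
have le_l : (N - m <= l)%N.
  rewrite leq_subLR addnC leqNgt; apply/negP => /uniformizerX_neq0.
  by rewrite tlm0 eqxx.
by exists (u * t ^+ (l - (N - m))); rewrite -mulrA -exprD subnK.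
Qed.

Lemma pideal_properX m :
  (m < N)%N -> pideal (t ^+ m.+1) \proper pideal (t ^+ m).
Proof.
move=> lt_mN; rewrite properE pideal_subX //=.
apply/negP => /subsetP/(_ (t ^+ m)); case/(_ _)/mem_pideal => [|b tm].
  by apply/mem_pideal; exists 1; rewrite mul1r.
(* t^m (1 - b t) = 0 and 1 - b t is invertible *)
have [c cK] := invertible_addM_nilpotent (- b) (invertible1 A) t_nilp.
have := uniformizerX_neq0 lt_mN; rewrite -[t ^+ m]mul1r -cK -mulrA mulrDl mul1r.
by rewrite mulrN mulNr [t * b]mulrC -mulrA -exprS -tm subrr mulr0 eqxx.
Qed.

(** Multiplication by t maps (t^m) onto (t^(m+1)), and for m < N its kernel, the
annihilator (t^(N-1)) of t, lies in (t^m). *)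
Lemma card_pidealX m :
  (m <= N)%N -> #|pideal (t ^+ m)| = (#|pideal (t ^+ N.-1)| ^ (N - m))%N.
Proof.
move=> le_mN; rewrite -{1}(subKn le_mN).
elim: (N - m)%N (leq_subr m N) => [_|l IHl lt_lN].
  by rewrite subn0 t_nilp pideal0 cards1.
have [_ ID IM] := pideal_is_ideal (t ^+ (N - l.+1)).
rewrite (@card_fibres _ _ (fun a => a * t)); first last.
- move=> x y Ix Iy; apply: ID => //; rewrite -mulN1r; exact: IM.
- by move=> x y; rewrite mulrBl.
rewrite expnSr -IHl ?(ltnW lt_lN) //; congr (_ * _)%N.
  congr #|pred_of_set _|; apply/setP => a.
  have tE : t ^+ (N - l) = t ^+ (N - l.+1) * t by rewrite -exprSr subnSK.
  apply/imsetP/mem_pideal => [[_ /mem_pideal[b ->] ->]|[b ->]].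
    by exists b; rewrite tE mulrA.
  exists (b * t ^+ (N - l.+1)); last by rewrite tE mulrA.
  by apply/mem_pideal; exists b.
congr #|pred_of_set _|; apply/setP => a; rewrite inE.
have N0 : (0 < N)%N by apply: leq_ltn_trans lt_lN.
apply/andP/mem_pideal => [[_ /eqP at0]|[b ->]].
  have /(annihilatorX _ N0) : a * t ^+ 1 = 0 by rewrite expr1.
  by rewrite subn1.
split; last by rewrite -mulrA -exprSr prednK // t_nilp mulr0.
have /pideal_subX/subsetP-> // : (N - l.+1 <= N.-1)%N.
  by rewrite -subn1; apply: leq_sub2l.
by apply/mem_pideal; exists b.
Qed.

End Uniformizer.

(** * Frobenius up to a square-zero element dividing p *)

Section Frobenius.

Variables (A : comNzRingType) (c : A) (p : nat).

Hypothesis p_prime : prime p.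
Hypothesis c_sqr : c ^+ 2 = 0.
Hypothesis p_mul : exists u, p%:R = c * u.

Lemma exprDp x y : exists e, (x + y) ^+ p = x ^+ p + y ^+ p + c * y * e.
Proof.
have [u pu] := p_mul; have p0 := prime_gt0 p_prime.
rewrite exprDn -(prednK p0) big_ord_recl big_ord_recr /= subn0 expr0 mulr1 bin0.
rewrite mulr1n /bump /= !add1n !prednK // subnn binn mulr1n expr0 mul1r.
rewrite addrA [_ + _ + y ^+ p]addrAC.
have [e ->] : exists e, \sum_(i < p.-1)
    (x ^+ (p - bump 0 i) * y ^+ bump 0 i) *+ 'C(p, bump 0 i) = c * y * e.
  apply: (big_ind (fun z => exists e, z = c * y * e)).
  - by exists 0; rewrite mulr0.
  - by move=> _ _ [a ->] [b ->]; exists (a + b); rewrite mulrDr.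
  move=> i _; rewrite /bump leq0n add1n.
  have /dvdnP[q ->] : (p %| 'C(p, i.+1))%N.
    by apply: prime_dvd_bin => //=; have := ltn_ord i; rewrite -ltnS prednK.
  exists (u * q%:R * x ^+ (p - i.+1) * y ^+ i).
  by rewrite -mulr_natr natrM pu exprS; ring.
by exists e; rewrite addrAC.
Qed.

Lemma exprp_congr x w : (x + c * w) ^+ p = x ^+ p.
Proof.
have [e ->] := exprDp x (c * w).
rewrite [c * (_ * _)]mulrA -expr2 c_sqr !mul0r addr0 exprMn.
have -> : c ^+ p = 0.
  by rewrite -(subnK (prime_gt1 p_prime)) exprD c_sqr mulr0.
by rewrite mul0r addr0.
Qed.

(** The point is the factor x - a of the error term: when x - a is nilpotent, the
error only perturbs a unit multiple of c by c times a nilpotent.  In the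
induction step, raising a^(p^i) + t with t = x^(p^i) - a^(p^i) to the power p
makes an error c t e, and c t = c (x - a)^(p^i) because c^2 = 0. *)
Lemma subr_exprpX x a i :
  exists e, x ^+ (p ^ i) - a ^+ (p ^ i) =
            (x - a) ^+ (p ^ i) + c * (x - a) * e.
Proof.
elim: i => [|i [e IHi]]; first by exists 0; rewrite !expr1 mulr0 addr0.
set t := x ^+ _ - a ^+ _ in IHi.
have tp : t ^+ p = (x - a) ^+ (p ^ i) ^+ p.
  by rewrite IHi -[c * _ * e]mulrA exprp_congr.
have ct : c * t = c * (x - a) ^+ (p ^ i).
  by rewrite IHi mulrDr !mulrA -expr2 c_sqr !mul0r addr0.
have [e1] := exprDp (a ^+ (p ^ i)) t; rewrite [a ^+ _ + t]addrC subrK tp ct.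
rewrite expnSr !exprM => ->.
have [q ->] : exists q, (p ^ i)%N = q.+1.
  by exists (p ^ i).-1; rewrite prednK // expn_gt0 prime_gt0.
by exists ((x - a) ^+ q * e1); rewrite [(x - a) ^+ q.+1]exprS; ring.
Qed.

(** The p^i-th power of f h = x - a is c (b - f h e) for some e, where b - f h e
is invertible because f is nilpotent. *)
Lemma exprp_unit_mul x a b f h i :
  x ^+ (p ^ i) = a ^+ (p ^ i) + c * b -> x - a = f * h ->
  invertible b -> invertible h -> (exists l, f ^+ l = 0) ->
  exists2 v, invertible v & f ^+ (p ^ i) = c * v.
Proof.
move=> xE fhE b_inv h_inv [l fl0].
have [e] := subr_exprpX x a i; rewrite xE fhE addrAC subrr add0r => E.
have [w wK] := invertibleX (p ^ i) h_inv.
have v_inv : invertible (b + f * (- (h * e))).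
  exact: invertible_addM_nilpotent b_inv fl0.
exists (w * (b + f * (- (h * e)))).
  by apply: invertibleM => //; exists (h ^+ (p ^ i)); rewrite mulrC.
have -> : f ^+ (p ^ i) = w * (f * h) ^+ (p ^ i).
  by rewrite exprMn mulrCA wK mulr1.
have -> : (f * h) ^+ (p ^ i) = c * b - c * (f * h) * e by rewrite E addrK.
by ring.
Qed.

End Frobenius.

(** * A finite ring of square-zero maximal ideal over its residue field *)

Section ResidueField.

Variables (R : finComNzRingType) (gamma : R).
Variables (F : finFieldType) (red : {rmorphism R -> F}).

Hypothesis gamma_neq0 : gamma != 0.
Hypothesis gamma_sqr : gamma ^+ 2 = 0.
Hypothesis red_surj : forall y : F, exists x : R, red x = y.
Hypothesis red_ker : forall x : R, (red x == 0) = (x \in pideal gamma).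

Lemma red_eq0 x : red x = 0 -> exists w, x = w * gamma.
Proof. by move/eqP; rewrite red_ker => /mem_pideal. Qed.

Lemma red_invertible x : red x != 0 -> invertible x.
Proof.
move=> rx0; have [y ry] := red_surj (red x)^-1.
apply: (@invertible_factor _ _ y).
have [w xyE] : exists w, x * y - 1 = w * gamma.
  by apply: red_eq0; rewrite rmorphB rmorphM rmorph1 ry mulfV ?subrr.
rewrite -(subrK 1 (x * y)) addrC xyE mulrC.
exact: invertible_addM_nilpotent (invertible1 R) gamma_sqr.
Qed.

Lemma invertible_or_mul_gamma x : invertible x \/ exists w, x = w * gamma.
Proof.
have [/red_eq0|/red_invertible] := eqVneq (red x) 0; first by right.
by left.
Qed.

(** |R| is |(gamma)|^2, as gamma is a uniformizer, and |(gamma)| |F|, by the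
fibres of red. *)
Lemma card_residue : #|R| = (#|F| ^ 2)%N.
Proof.
have := @card_pidealX R gamma 2 invertible_or_mul_gamma gamma_sqr gamma_neq0
  0 isT.
rewrite pideal1 cardsT subn0 expr1 => cardR; rewrite cardR; congr (_ ^ 2)%N.
have gammaR_gt0 : (0 < #|pideal gamma|)%N.
  by apply/card_gt0P; exists 0; rewrite -red_ker rmorph0.
apply/eqP; rewrite -(eqn_pmul2r gammaR_gt0) mulnn -cardR -cardsT; apply/eqP.
rewrite (@card_fibres R F red); first last.
- by move=> x y _ _; rewrite inE.
- exact: rmorphB.
congr (_ * _)%N; last by apply: eq_card => x; rewrite !inE red_ker.
rewrite -cardsT; congr #|pred_of_set _|; apply/setP => y; rewrite inE.
by have [x <-] := red_surj y; apply/imsetP; exists x.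
Qed.

Lemma map_red_surj (q : {poly F}) : exists q', map_poly red q' = q.
Proof.
have ex y : exists x, red x == y by have [x <-] := red_surj y; exists x.
exists (\poly_(i < size q) xchoose (ex q`_i)); apply/polyP => i.
rewrite coef_map coef_poly; case: ltnP => [_|le_qi].
  exact/eqP/(xchooseP (ex _)).
by rewrite [LHS]raddf0 nth_default.
Qed.

Lemma map_red_eq0 (q : {poly R}) :
  map_poly red q = 0 -> exists w, q = gamma *: w.
Proof.
move=> q0; have ex i : exists w, q`_i == gamma * w.
  have [|w ->] := @red_eq0 q`_i; first by rewrite -coef_map q0 coef0.
  by exists w; rewrite mulrC.
exists (\poly_(i < size q) xchoose (ex i)); apply/polyP => i.
rewrite coefZ coef_poly; case: ltnP => [_|le_qi].
  exact/eqP/(xchooseP (ex _)).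
by rewrite mulr0 nth_default.
Qed.

Lemma natr_residue_char p m :
  prime p -> #|F| = (p ^ m)%N -> exists u : R, p%:R = gamma * u.
Proof.
move=> p_prime cardF; have [|w ->] := @red_eq0 (p%:R : R); last first.
  by exists w; rewrite mulrC.
rewrite rmorph_nat; apply/eqP.
have : (p%:R : F) ^+ m == 0.
  (* translating the sum of all elements by 1 adds |F| to it *)
  have := erefl (\sum_(x : F) x).
  rewrite {1}(reindex_inj (addIr 1)) big_split /= sumr_const cardF natrX.
  by move/eqP; rewrite -subr_eq0 addrAC subrr add0r.
by rewrite expf_eq0 => /andP[].
Qed.

End ResidueField.

(** * The quotient by a monic polynomial *)

Section PolynomialQuotient.

Variables (R : finComNzRingType) (k : {poly R}).

Hypothesis k_monic : k \is monic.
Hypothesis k_size : (1 < size k)%N.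

Lemma mk_monic_id : mk_monic k = k.
Proof. by rewrite /mk_monic k_size k_monic. Qed.

Lemma in_qpoly_id (c : {poly %/ k}) : in_qpoly k (c : {poly R}) = c.
Proof. by apply/val_inj/in_qpoly_small/size_mk_monic. Qed.

Lemma in_qpoly_eq0 (q : {poly R}) : in_qpoly k q = 0 <-> exists w, q = w * k.
Proof.
split=> [/(congr1 val) /= | [w ->]].
  rewrite mk_monic_id => q0; exists (Pdiv.Ring.rdivp q k).
  by rewrite {1}[q](Pdiv.RingMonic.rdivp_eq k_monic) q0 addr0.
by apply: val_inj; rewrite /= mk_monic_id Pdiv.RingMonic.rmodp_mull.
Qed.

Lemma in_qpoly_modulus : in_qpoly k k = 0.
Proof. by apply/in_qpoly_eq0; exists 1; rewrite mul1r. Qed.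

(** Modulo gamma, f either divides a or satisfies a Bezout relation with it; in
both cases the relation lifts to R up to a multiple of gamma, which in the
quotient is a multiple of the nilpotent f. *)
Lemma qpoly_invertible_or_mul (gamma : R) (F : finFieldType)
    (red : {rmorphism R -> F}) (f : {poly R}) l :
    (forall y : F, exists x : R, red x = y) ->
    (forall x : R, (red x == 0) = (x \in pideal gamma)) ->
    irreducible_poly (map_poly red f) ->
    in_qpoly k f ^+ l = 0 ->
    (exists v, in_qpoly k gamma%:P = v * in_qpoly k f) ->
  forall a : {poly %/ k}, invertible a \/ exists b, a = b * in_qpoly k f.
Proof.
move=> red_surj red_ker f_irr f_nilp [v gammaE] a.
have lift := map_red_surj red_surj; have ker := map_red_eq0 red_ker.
have gammaK w : in_qpoly k (gamma *: w) = in_qpoly k w * v * in_qpoly k f.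
  by rewrite -mul_polyC rmorphM /= gammaE mulrC mulrA.
have aE := in_qpoly_id a; set a0 : {poly R} := a in aE.
have [/dvdpP[q qE]|f_ndiv] := boolP (map_poly red f %| map_poly red a0)%R.
  right; have [q' q'E] := lift q.
  have [w wE] : exists w, a0 - q' * f = gamma *: w.
    by apply: ker; rewrite rmorphB rmorphM /= q'E qE subrr.
  exists (in_qpoly k w * v + in_qpoly k q').
  by rewrite mulrDl -gammaK -rmorphM -rmorphD /= -wE subrK.
left; move: f_ndiv; rewrite -irreducible_poly_coprime //.
case/Bezout_eq1_coprimepP=> -[u1 u2] /= uE.
have [[u1' u1E] [u2' u2E]] := (lift u1, lift u2).
have [w wE] : exists w, u2' * a0 - (1 - u1' * f) = gamma *: w.
  apply: ker; rewrite !rmorphB !rmorphM rmorph1 /= u1E u2E -uE.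
  by rewrite [_ + u2 * _]addrC addrK subrr.
apply: (@invertible_factor _ _ (in_qpoly k u2')).
have -> : a * in_qpoly k u2' =
          1 + in_qpoly k f * (in_qpoly k w * v - in_qpoly k u1').
  rewrite mulrC -{1}aE -rmorphM /= -(subrK (1 - u1' * f) (u2' * a0)) wE.
  by rewrite rmorphD rmorphB rmorph1 rmorphM /= gammaK; ring.
exact: invertible_addM_nilpotent (invertible1 _) f_nilp.
Qed.

(** * Reciprocal polynomials and inversion of the variable *)

(** The quotient by the reciprocal of k enters only as a surjection h whose
kernel is generated by that reciprocal. *)
Section Reciprocal.

Variables (B : comNzRingType) (h : {rmorphism {poly R} -> B}).

Hypothesis k0_invertible : invertible k`_0.
Hypothesis h_surj : forall b, exists q, h q = b.
Hypothesis h_ker : forall q, h q = 0 <-> in_pideal (recip k) q.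

Lemma coef0_recip (R' : nzRingType) (q : {poly R'}) :
  (recip q)`_0 = lead_coef q.
Proof.
rewrite coef_poly subn0 lead_coefE; case: ltnP => //.
by rewrite leqn0 size_poly_eq0 => /eqP ->; rewrite coef0.
Qed.

Lemma recip_eq0 (R' : nzRingType) (q : {poly R'}) : recip q = 0 -> q = 0.
Proof.
by move=> q0; apply/eqP; rewrite -lead_coef_eq0 -coef0_recip q0 coef0.
Qed.

Lemma split_constant (R' : nzRingType) (q : {poly R'}) :
  exists w, q = w * 'X + (q`_0)%:P.
Proof.
elim/poly_ind: q => [|q c _]; first by exists 0; rewrite coef0 mul0r addr0.
by exists q; rewrite coefD coefMX coefC /= add0r.
Qed.

(** The constant coefficient of recip k is the leading coefficient 1 of k, so 1
is a multiple of the variable modulo recip k. *)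
Lemma morphX_invertible : invertible (h 'X).
Proof.
have [w] := split_constant (recip k).
rewrite coef0_recip (monicP k_monic) => kE.
have : h (recip k) = 0 by apply/h_ker; exists 1; rewrite mul1r.
rewrite kE rmorphD rmorph1 rmorphM /= => /eqP; rewrite addr_eq0 => /eqP hE.
by exists (- h w); rewrite mulNr hE opprK.
Qed.

Variable xi : B.
Hypothesis xiX : xi * h 'X = 1.

(** Modulo k this is the isomorphism called phi in the introduction; xi stands
for the inverse of the variable. *)
Definition eval_inv (q : {poly R}) : B := (map_poly (h \o polyC) q).[xi].

Fact eval_inv_is_zmod_morphism : zmod_morphism eval_inv.
Proof. by move=> x y; rewrite /eval_inv rmorphB /= hornerD hornerN. Qed.

Fact eval_inv_is_monoid_morphism : monoid_morphism eval_inv.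
Proof.
by split=> [|x y]; rewrite /eval_inv ?rmorph1 ?hornerC // rmorphM /= hornerM.
Qed.

HB.instance Definition _ :=
  GRing.isZmodMorphism.Build {poly R} B eval_inv eval_inv_is_zmod_morphism.
HB.instance Definition _ :=
  GRing.isMonoidMorphism.Build {poly R} B eval_inv eval_inv_is_monoid_morphism.

Lemma eval_invC c : eval_inv c%:P = h c%:P.
Proof. by rewrite /eval_inv map_polyC hornerC. Qed.

Lemma eval_invX : eval_inv 'X = xi.
Proof. by rewrite /eval_inv map_polyX hornerX. Qed.

(** Reversing the coefficients of q amounts to substituting the inverse of the
variable and multiplying by the power of the variable that clears the
denominators; both sides vanish for q = 0. *)
Lemma morph_recip q : h (recip q) = h 'X ^+ (size q).-1 * eval_inv q.
Proof.
have XxiK n : h 'X ^+ n * xi ^+ n = 1 by rewrite -exprMn mulrC xiX expr1n.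
rewrite -{3}[q]coefK /recip !poly_def !rmorph_sum mulr_sumr /=.
rewrite (reindex_inj rev_ord_inj) /=; apply: eq_bigr => i _.
have -> : ((size q).-1 - (size q - i.+1) = i)%N.
  by rewrite -subn1 -subnDA addnC subnDA subKn ?subn1 ?ltn_ord.
rewrite -!mul_polyC !rmorphM !rmorphXn /= eval_invC eval_invX mulrCA.
have -> : (size q).-1 = (size q - i.+1 + i)%N.
  by rewrite -[RHS]/(_.+1.-1) -addnS subnK ?ltn_ord.
by rewrite exprD -mulrA XxiK mulr1.
Qed.

(** If q is killed and c is its remainder modulo k, then recip c is a multiple
of recip k; the leading coefficient of recip k is the invertible constant
coefficient of k, so comparing degrees leaves only c = 0. *)
Lemma eval_inv_eq0 q : eval_inv q = 0 <-> in_qpoly k q = 0.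
Proof.
have k_ev0 : eval_inv k = 0.
  have hk0 : h (recip k) = 0 by apply/h_ker; exists 1; rewrite mul1r.
  apply: (invertible_inj (invertibleX (size k).-1 morphX_invertible)).
  by rewrite -morph_recip hk0 mulr0.
split=> [q0|/in_qpoly_eq0[w ->]]; last by rewrite rmorphM /= k_ev0 mulr0.
move cE : (in_qpoly k q) => c.
have [w qE] : exists w, q - c = w * k.
  by apply/in_qpoly_eq0; rewrite rmorphB /= in_qpoly_id cE subrr.
have : h (recip (c : {poly R})) = 0.
  rewrite morph_recip -[c : {poly R}](subKr q) qE rmorphB rmorphM /= q0 k_ev0.
  by rewrite mulr0 subrr mulr0.
case/h_ker=> u uE.
have c_size : (size (c : {poly R}) < size k)%N.
  by apply: (leq_trans (size_mk_monic c)); rewrite mk_monic_id.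
have recip_k_lead : (recip k)`_(size k).-1 = k`_0.
  by rewrite coef_poly subnn prednK ?leqnn // ltnW.
have [v vk0] := k0_invertible.
have u0 : u = 0.
  apply/eqP; apply: contraTT c_size => u_neq0; rewrite -leqNgt.
  have k0_neq0 : k`_0 != 0.
    by apply: contra_eq_neq vk0 => ->; rewrite mulr0 eq_sym oner_eq0.
  have recip_k_size : size (recip k) = size k.
    apply/eqP; rewrite eqn_leq size_poly /=.
    apply: contraNT k0_neq0; rewrite -ltnNge -recip_k_lead => recip_small.
    by rewrite nth_default // -ltnS prednK // ltnW.
  have lead_neq0 : lead_coef u * lead_coef (recip k) != 0.
    rewrite lead_coefE [lead_coef (recip k)]lead_coefE.
    rewrite recip_k_size recip_k_lead.
    apply: contra u_neq0 => /eqP/(congr1 ( *%R^~ v)).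
    rewrite mul0r -mulrA [_ * v]mulrC vk0 mulr1 => /eqP.
    by rewrite lead_coef_eq0.
  apply: (@leq_trans (size (recip (c : {poly R})))); last exact: size_poly.
  rewrite uE size_proper_mul // recip_k_size -[size u]prednK ?size_poly_gt0 //.
  exact: leq_addl.
by apply/val_inj/recip_eq0; rewrite uE u0 mul0r.
Qed.

(** The variable is invertible modulo k too, as k`_0 is invertible, and its
inverse there is sent to h 'X. *)
Lemma eval_inv_surj b : exists q, eval_inv q = b.
Proof.
have [w kE] := split_constant k; have [u uk0] := k0_invertible.
have X'E : eval_inv (- (u *: w)) = h 'X.
  apply: (@invertible_inj _ xi); first by exists (h 'X); rewrite mulrC.
  rewrite xiX -eval_invX -rmorphM /=.
  have -> : 'X * - (u *: w) = 1 - u%:P * k.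
    by rewrite [in RHS]kE mulrDr -polyCM uk0 -mul_polyC polyC1; ring.
  rewrite rmorphB rmorphM rmorph1 /=.
  by have /eval_inv_eq0-> := in_qpoly_modulus; rewrite mulr0 subr0.
have [q <-] := h_surj b; elim/poly_ind: q => [|q c [q' q'E]].
  by exists 0; rewrite !rmorph0.
exists (q' * - (u *: w) + c%:P).
by rewrite !rmorphD !rmorphM /= q'E X'E eval_invC.
Qed.

Lemma recip_orthogonal b (y : {poly %/ k}) :
  (forall c : {poly %/ k}, c \in pideal y ->
     eval_inv b * h (recip (c : {poly R})) = 0) <-> in_qpoly k b * y = 0.
Proof.
have E (c : {poly %/ k}) :
    eval_inv b * h (recip (c : {poly R})) = 0 <-> in_qpoly k b * c = 0.
  rewrite morph_recip mulrCA -rmorphM /=.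
  rewrite -[in X in _ <-> X](in_qpoly_id c) -rmorphM /= -eval_inv_eq0.
  split=> [|->]; last by rewrite mulr0.
  rewrite -[in X in X -> _](mulr0 (h 'X ^+ (size c).-1)).
  by apply: invertible_inj; apply: invertibleX; exact: morphX_invertible.
split=> [by_c|by0 c /mem_pideal[z ->]].
  by apply/E; apply: by_c; apply/mem_pideal; exists 1; rewrite mul1r.
by apply/E; rewrite mulrCA by0 mulr0.
Qed.

(** Through phi the complement becomes the annihilator of a power of f, a power
of f again; and h (recip f) differs from eval_inv f by a power of the
invertible h 'X, so the powers of both generate the same ideals. *)
Lemma recip_orthogonal_uniformizer (f : {poly R}) N nu a :
    (forall a : {poly %/ k}, invertible a \/ exists b, a = b * in_qpoly k f) ->
    in_qpoly k f ^+ N = 0 -> in_qpoly k f ^+ N.-1 != 0 -> (nu <= N)%N ->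
  (forall c : {poly %/ k}, c \in pideal (in_qpoly k f ^+ nu) ->
     a * h (recip (c : {poly R})) = 0)
  <-> in_pideal (h (recip f) ^+ (N - nu)) a.
Proof.
move=> f_unif f_nilp f_neq0 le_nuN; have [b <-] := eval_inv_surj a.
rewrite recip_orthogonal (annihilatorX f_unif f_nilp f_neq0 _ le_nuN).
rewrite morph_recip exprMn -exprM; set e := (_ * _)%N.
have XxiK : xi ^+ e * h 'X ^+ e = 1 by rewrite -exprMn xiX expr1n.
have evE q : in_qpoly k b = in_qpoly k q * in_qpoly k f ^+ (N - nu)
    <-> eval_inv b = eval_inv q * eval_inv f ^+ (N - nu).
  rewrite -!rmorphXn -!rmorphM; split=> /eqP; rewrite -subr_eq0 -rmorphB.
    by move/eqP/eval_inv_eq0; rewrite rmorphB => /eqP; rewrite subr_eq0 => /eqP.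
  by move/eqP/eval_inv_eq0; rewrite rmorphB => /eqP; rewrite subr_eq0 => /eqP.
split=> [[c]|[z]].
  rewrite -[c]in_qpoly_id => /evE ->; exists (eval_inv c * xi ^+ e).
  by rewrite -mulrA [xi ^+ e * _]mulrA XxiK mul1r.
rewrite mulrA; have [q <-] := eval_inv_surj (z * h 'X ^+ e) => /evE ->.
by exists (in_qpoly k q).
Qed.

End Reciprocal.

End PolynomialQuotient.

(** * The ring K and its dual *)

Lemma teichmuller_invertible (R : finComNzRingType) n (zeta x : R) :
  n.-primitive_root zeta -> x \in teichmuller n zeta -> x != 0 -> invertible x.
Proof.
move=> zeta_n; rewrite !inE => /orP[/eqP->|/imsetP[i _ ->] _].
  by rewrite eqxx.
apply: invertibleX; exists (zeta ^+ n.-1).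
by rewrite -exprSr prednK ?(prim_order_gt0 zeta_n) // (prim_expr_order zeta_n).
Qed.

Theorem theorem3p1
  (R : finComNzRingType) (gamma : R) (p m : nat)
  (* the residue field R/<gamma>, with its projection *)
  (F : finFieldType) (red : {rmorphism R -> F})
  (p_prime : prime p)
  (R_chain : chain_ring R)
  (gamma_max : maximal_ideal (pideal gamma))
  (gamma_neq0 : gamma != 0)
  (gamma_sqr : gamma ^+ 2 = 0)
  (red_surj : forall y : F, exists x : R, red x = y)
  (red_ker : forall x : R, (red x == 0) = (x \in pideal gamma))
  (card_F : #|F| = (p ^ m)%N)
  (zeta : R) (zeta_order : (p ^ m).-1.-primitive_root zeta)
  (n s : nat) (n_gt0 : (0 < n)%N) (s_gt0 : (0 < s)%N) (n_p : coprime n p)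
  (alpha beta lambda alpha0 : R)
  (alpha_T : alpha \in teichmuller (p ^ m).-1 zeta) (alpha_neq0 : alpha != 0)
  (beta_T : beta \in teichmuller (p ^ m).-1 zeta)
  (lambdaE : lambda = alpha + gamma * beta)
  (alpha0_T : alpha0 \in teichmuller (p ^ m).-1 zeta)
  (alpha0E : alpha0 ^+ (p ^ s) = alpha)
  (r : nat) (f : 'I_r -> {poly R})
  (f_prod : 'X^n - alpha0%:P = \prod_(i < r) f i)
  (f_monic : forall i, f i \is monic)
  (f_coprime : forall i1 i2, i1 != i2 -> comaximal (f i1) (f i2))
  (f_irr : forall i, irreducible_poly (map_poly red (f i)))
  (g k : 'I_r -> {poly R})
  (kE : forall i, k i = f i ^+ (p ^ s) + gamma *: g i)
  (k_prod : 'X^(n * p ^ s) - lambda%:P = \prod_(i < r) k i)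
  (k_monic : forall i, k i \is monic)
  (k_coprime : forall i1 i2, i1 != i2 -> comaximal (k i1) (k i2))
  (k_deg : forall i, (size (k i)).-1 = ((size (f i)).-1 * p ^ s)%N)
  (j : 'I_r)
  (kstar : idealr {poly R})
  (kstarE : forall a : {poly R}, a \in kstar <-> in_pideal (recip (k j)) a)
  (beta_neq0 : beta != 0) :
  let K : finComNzRingType := {poly %/ k j} in
  let Khat : comNzRingType := {ideal_quot kstar} in
  let d := (size (f j)).-1 in
  let fK : K := in_qpoly (k j) (f j) in
  let fKhat : Khat := \pi_{ideal_quot kstar} (recip (f j)) in
  [/\ chain_ring K,
      forall I : {set K}, is_ideal I <->
        (exists2 nu, (nu <= 2 * p ^ s)%N & I = pideal (fK ^+ nu)),
      [/\ pideal (fK ^+ 0) = [set: K],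
          pideal (fK ^+ (2 * p ^ s)) = [set 0] &
          forall nu, (nu < 2 * p ^ s)%N ->
            pideal (fK ^+ nu.+1) \proper pideal (fK ^+ nu)] &
      forall nu, (nu <= 2 * p ^ s)%N ->
        #|pideal (fK ^+ nu)| = (p ^ (m * d * (2 * p ^ s - nu)))%N /\
        forall a : Khat,
          @orth_compl R (k j) kstar (pideal (fK ^+ nu)) a <->
          in_pideal (fKhat ^+ (2 * p ^ s - nu)) a].
Proof.
move=> K Khat d fK fKhat.
have d_gt0 : (0 < d)%N.
  case: (f_irr j); rewrite size_map_poly_id0; last first.
    by rewrite (monicP (f_monic j)) rmorph1 oner_neq0.
  by rewrite /d; case: size => [|[]].
have p_gt0 := prime_gt0 p_prime.
have ps_gt0 : (0 < p ^ s)%N by rewrite expn_gt0 p_gt0.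
set N := (2 * p ^ s)%N.
have N_gt0 : (0 < N)%N by rewrite muln_gt0.
have k_size : (1 < size (k j))%N.
  have : (0 < (size (k j)).-1)%N by rewrite k_deg muln_gt0 d_gt0.
  by case: size => [|[]].
have K_mod := in_qpoly_modulus (k_monic j) k_size.
have [pu pE] := natr_residue_char red_ker p_prime card_F.
have alpha_inv := teichmuller_invertible zeta_order alpha_T alpha_neq0.
have beta_inv := teichmuller_invertible zeta_order beta_T beta_neq0.
pose q : {rmorphism {poly R} -> K} := in_qpoly (k j).
pose c : K := q gamma%:P.
have c_sqr : c ^+ 2 = 0.
  by rewrite -(rmorph0 q) -polyC0 -gamma_sqr polyC_exp rmorphXn.
(* kE already shows that fK ^+ (p ^ s) is a multiple of c, hence that fK is
   nilpotent; that the cofactor is invertible needs beta *)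
have f_ps : fK ^+ (p ^ s) = - (c * q (g j)).
  have : q (k j) = 0 by exact: K_mod.
  rewrite kE rmorphD rmorphXn /= -mul_polyC rmorphM /= => /eqP.
  by rewrite addr_eq0 => /eqP.
have f_nilp : fK ^+ N = 0.
  by rewrite /N mulnC exprM f_ps sqrrN exprMn c_sqr mul0r.
have [v v_inv cE] : exists2 v, invertible v & fK ^+ (p ^ s) = c * v.
  apply: (@exprp_unit_mul K c p p_prime c_sqr _ (q 'X ^+ n) (q alpha0%:P)
            (q beta%:P) fK (q (\prod_(i < r | i != j) f i)) s).
  - by exists (q pu%:P); rewrite -rmorphM -polyCM -pE !rmorph_nat.
  - have : q ('X^(n * p ^ s) - lambda%:P) = 0.
      by rewrite k_prod (bigD1 j) //= rmorphM /= [in_qpoly _ _]K_mod mul0r.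
    rewrite rmorphB lambdaE -alpha0E polyCD polyCM polyC_exp rmorphD rmorphM.
    by rewrite !rmorphXn exprM => /eqP; rewrite subr_eq0 => /eqP.
  - by rewrite -rmorphXn -rmorphB f_prod (bigD1 j) //= rmorphM.
  - by apply: rmorph_invertible; apply: rmorph_invertible.
  - rewrite rmorph_prod; apply: invertible_prod => i ij.
    have [u [w uwE]] := f_coprime _ _ ij.
    apply: (@invertible_factor _ _ (q u)).
    have -> : q (f i) * q u = 1 + fK * (- q w).
      by rewrite -(rmorph1 q) -uwE rmorphD !rmorphM /=; ring.
    exact: invertible_addM_nilpotent (invertible1 _) f_nilp.
  - by exists N.
have [v' v'v] := v_inv.
have f_unif : forall a : K, invertible a \/ exists b, a = b * fK.
  apply: (qpoly_invertible_or_mul red_surj red_ker (f_irr j) f_nilp).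
  exists (v' * fK ^+ (p ^ s).-1).
  rewrite -mulrA -exprSr prednK // [in_qpoly _ (f j) ^+ _]cE.
  by rewrite [c * v]mulrC mulrA v'v mul1r.
(* fK ^+ N.-1 is a unit times the class of gamma *: f j ^+ (p ^ s).-1, which is
   its own representative since its degree is less than that of k j *)
have f_neq0 : fK ^+ N.-1 != 0.
  have -> : fK ^+ N.-1 = v * q (gamma *: f j ^+ (p ^ s).-1).
    have -> : N.-1 = (p ^ s + (p ^ s).-1)%N.
      by rewrite /N mul2n -addnn -[in RHS]subn1 addnBA // subn1.
    by rewrite exprD cE -mul_polyC rmorphM rmorphXn /=; ring.
  apply/eqP => v0.
  have : q (gamma *: f j ^+ (p ^ s).-1) = 0.
    by apply: (invertible_inj v_inv); rewrite mulr0.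
  have ff_monic : f j ^+ (p ^ s).-1 \is monic by apply: monic_exp.
  move/(congr1 val); rewrite /= Pdiv.CommonRing.rmodp_small; last first.
    rewrite (mk_monic_id (k_monic j) k_size).
    apply: (leq_ltn_trans (size_scale_leq _ _)).
    rewrite -[size (k j)]prednK ?(ltnW k_size) // k_deg.
    rewrite ltnS; apply: (leq_trans (size_exp_leq _ _)).
    by rewrite -/d ltn_pmul2l // ltn_predL.
  move/(congr1 (fun w : {poly R} => w`_(size (f j ^+ (p ^ s).-1)).-1)).
  rewrite coefZ -lead_coefE (monicP ff_monic) mulr1 coef0 => /eqP.
  by rewrite (negPf gamma_neq0).
have cardK : #|K| = (#|pideal (fK ^+ N.-1)| ^ N)%N.
  have := card_pidealX f_unif f_nilp f_neq0 (leq0n N); rewrite subn0 => <-.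
  by rewrite pideal1 cardsT.
(* comparing the two expressions for #|K|, both N-th powers *)
have card_top : #|pideal (fK ^+ N.-1)| = (p ^ (m * d))%N.
  apply/eqP; rewrite -(eqn_exp2r _ _ N_gt0) -cardK; apply/eqP.
  rewrite [LHS](card_monic_qpoly k_size (k_monic j)) k_deg.
  rewrite (card_residue gamma_neq0 gamma_sqr red_surj red_ker) card_F.
  by rewrite -!expnM /N -/d; congr (_ ^ _)%N; ring.
split.
- exact: uniformizer_chain_ring f_unif f_nilp.
- move=> I; split=> [|[nu _ ->]]; last exact: pideal_is_ideal.
  exact: ideal_uniformizer.
- split=> [||nu lt_nu].
  + exact: pideal1.
  + by rewrite f_nilp pideal0.
  + exact: (pideal_properX f_nilp f_neq0).
move=> nu le_nu; split.
  by rewrite (card_pidealX f_unif f_nilp f_neq0) // card_top -expnM.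
pose h : {rmorphism {poly R} -> Khat} := \pi_Khat.
have h_surj b : exists a, h a = b by exists (repr b); rewrite /h /= reprK.
have h_ker a : h a = 0 <-> in_pideal (recip (k j)) a.
  rewrite -kstarE -[a in a \in _]subr0 Quotient.idealrBE -(rmorph0 h).
  by split=> [/eqP|/eqP].
(* the constant coefficients of the factors k i multiply up to - lambda *)
have k0_inv : invertible (k j)`_0.
  have : invertible (- lambda).
    apply: invertibleN; rewrite lambdaE.
    exact: invertible_addM_nilpotent alpha_inv gamma_sqr.
  have <- : ('X^(n * p ^ s) - lambda%:P)`_0 = - lambda.
    by rewrite coefB coefC coefXn ltn_eqF ?muln_gt0 ?n_gt0 //= sub0r.
  rewrite k_prod (bigD1 j) //= -!horner_coef0 hornerM.
  exact: invertible_factor.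
have [xi xiX] := morphX_invertible (k_monic j) h_ker.
move=> a.
exact: (recip_orthogonal_uniformizer (k_monic j) k_size k0_inv h_surj h_ker xiX
          a f_unif f_nilp f_neq0 le_nu).
Qed.
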